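(* For every triple $u=(u_1,u_2,u_3)$ forming a $\mathbb Q$-basis of $K$, with $\xi=(\sigma_r(u_1),\sigma_r(u_2),\sigma_r(u_3))$ and $\nu=(\sigma_c(u_1),\sigma_c(u_2),\sigma_c(u_3))$, one has $$\langle\xi\times\nu,\xi\times\nu\rangle\neq0.$$ In particular no candidate of the algorithm is ever isotropic: excluding from the candidate set the triples with $\langle\xi\times\nu,\xi\times\nu\rangle=0$ removes nothing.
   Context: $K$ is a cubic number field of signature $(1,1)$, with real embedding $\sigma_r$ and one complex embedding $\sigma_c$ (up to conjugation). Cross and dot products on $\mathbb C^3$ are bilinear (non-Hermitian). A triple is isotropic if $\langle\xi\times\nu,\xi\times\nu\rangle=0$. The candidates of the algorithm are the triples obtained from a state (a triple of elements of an order $L\subset\mathcal O_K$ forming a $\mathbb Q$-basis of $K$, with positive real embeddings) by applying matrices in $\mathrm{GL}_3(\mathbb Z)$; they are therefore again $\mathbb Q$-bases of $K$. *)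

(* Defs.v *)
From HB Require Import structures.
From mathcomp Require Import all_boot all_order all_algebra all_field.
From mathcomp Require Import boolp classical_sets reals.
From mathcomp Require Import complex.

Set Implicit Arguments.
Unset Strict Implicit.
Unset Printing Implicit Defensive.

Import Order.TTheory GRing.Theory Num.Theory.
Local Open Scope classical_set_scope.
Local Open Scope ring_scope.
Local Open Scope complex_scope.

Definition dot (F : comNzRingType) (a b : 'cV[F]_3) : F :=
  \sum_i a i 0 * b i 0.

(* Indices are added modulo 3 in 'I_3. *)
Definition cross (F : comNzRingType) (a b : 'cV[F]_3) : 'cV[F]_3 :=
  \col_k (a (k + 1) 0 * b (k + 2%:R) 0 - a (k + 2%:R) 0 * b (k + 1) 0).

Section NumberField.
Variables (R : realType) (K : fieldExtType rat).

Definition nonreal_embedding (s : {rmorphism K -> R[i]}) : Prop :=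
  exists x : K, complex.Im (s x) != 0.

(* rho lists the real embeddings without repetition; tau lists the non-real
   embeddings, one from each conjugate pair. *)
Definition has_signature (r1 r2 : nat) : Prop :=
  exists (rho : 'I_r1 -> {rmorphism K -> R})
         (tau : 'I_r2 -> {rmorphism K -> R[i]}),
    [/\ (forall i j, rho i =1 rho j -> i = j),
        (forall s : {rmorphism K -> R}, exists i, s =1 rho i),
        (forall i, nonreal_embedding (tau i)),
        (forall i j,
           tau i =1 tau j \/ tau i =1 (fun x => (tau j x)^*) -> i = j)
      & (forall s : {rmorphism K -> R[i]}, nonreal_embedding s ->
           exists i, s =1 tau i \/ s =1 (fun x => (tau i x)^*))].

Definition algebraic_integer (x : K) : Prop :=
  integralOver (intr : int -> K) x.

Definition is_order (L : {pred K}) : Prop :=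
  [/\ GRing.subring_closed L,
      {in L, forall x, algebraic_integer x}
    & exists2 b : (\dim {:K}).-tuple K, basis_of {:K} b &
        forall x, x \in L <->
          exists c : 'I_(\dim {:K}) -> int, x = \sum_i tnth b i *~ c i].

Definition is_Qbasis (u : 'cV[K]_3) : Prop :=
  basis_of {:K} [tuple u i 0 | i < 3].

Definition is_state (sr : {rmorphism K -> R}) (L : {pred K})
    (u : 'cV[K]_3) : Prop :=
  [/\ (forall i, u i 0 \in L), is_Qbasis u & (forall i, 0 < sr (u i 0))].

Definition GL3Z_orbit (u : 'cV[K]_3) : set 'cV[K]_3 :=
  [set v | exists2 A : 'M[int]_3, A \in unitmx & v = map_mx intr A *m u].

Definition xi (sr : {rmorphism K -> R}) (u : 'cV[K]_3) : 'cV[R[i]]_3 :=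
  \col_i (sr (u i 0))%:C.

Definition nu (sc : {rmorphism K -> R[i]}) (u : 'cV[K]_3) : 'cV[R[i]]_3 :=
  \col_i sc (u i 0).

Definition isotropic (sr : {rmorphism K -> R}) (sc : {rmorphism K -> R[i]})
    : set 'cV[K]_3 :=
  [set u | dot (cross (xi sr u) (nu sc u)) (cross (xi sr u) (nu sc u)) = 0].

End NumberField.

(* Main.v *)
Require Import Defs.
From HB Require Import structures.
From mathcomp Require Import all_boot all_order all_algebra all_field.
From mathcomp Require Import boolp classical_sets reals.
From mathcomp Require Import complex.
From mathcomp Require Import ring.

(** Let theta be an element of K with non-real image under sc, and let A be the
    rational matrix of multiplication by theta in the basis u, so that
    A u = theta u.  Since theta is an eigenvalue of A over K, there is also a
    nonzero row vector w over K with w A = theta w.  Applying embeddings, xi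
    and nu become right eigenvectors of A for the eigenvalues sr theta and
    sc theta, while the image w' of w under the complex conjugate of sc is a
    left eigenvector for the conjugate of sc theta.  These three eigenvalues
    are pairwise distinct, so w' is orthogonal to xi and to nu, and xi and nu
    are linearly independent.  Hence xi x nu is a nonzero multiple of w', and
    it is isotropic only if w' is.

    But isotropy of w' is the image under a field embedding of the equation
    w_1^2 + w_2^2 + w_3^2 = 0 in K, and K has a real embedding, in which a sum
    of squares vanishes only if each term does.

    The step from orthogonality to isotropy is done with the identity
    a x (b x c) = (a.c) b - (a.b) c ([cross_crossr]) and yields
    [anisotropic_cross_eq0]; the eigenvector argument is
    [cross_eigenvectors_anisotropic].  The claim about candidates follows
    because a matrix in GL_3(Z) carries a rational basis to a rational
    basis. *)

Set Implicit Arguments.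
Unset Strict Implicit.
Unset Printing Implicit Defensive.

Import Order.TTheory GRing.Theory Num.Theory.
Local Open Scope classical_set_scope.
Local Open Scope ring_scope.
Local Open Scope complex_scope.

(** * Cross products *)

Section CrossProduct.
Variable F : comNzRingType.
Implicit Types a b c : 'cV[F]_3.

Lemma dotE a b :
  dot a b = a 0 0 * b 0 0 + a 1 0 * b 1 0 + a 2%:R 0 * b 2%:R 0.
Proof.
rewrite /dot !big_ord_recl big_ord0 addr0 addrA.
by congr (_ + a _ 0 * b _ 0 + a _ 0 * b _ 0); apply: val_inj.
Qed.

Lemma ord3_ind (P : 'I_3 -> Prop) : P 0 -> P 1 -> P 2%:R -> forall k, P k.
Proof.
move=> P0 P1 P2 [[|[|[|//]]] lt_k3].
- by have -> : Ordinal lt_k3 = 0 by apply: val_inj.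
- by have -> : Ordinal lt_k3 = 1 by apply: val_inj.
- by have -> : Ordinal lt_k3 = 2%:R by apply: val_inj.
Qed.

Lemma cross_crossr a b c :
  cross a (cross b c) = dot a c *: b - dot a b *: c.
Proof.
have e11 : 1 + 1 = 2%:R :> 'I_3 by apply: val_inj.
have e12 : 1 + 2%:R = 0 :> 'I_3 by apply: val_inj.
have e21 : 2%:R + 1 = 0 :> 'I_3 by apply: val_inj.
have e22 : 2%:R + 2%:R = 1 :> 'I_3 by apply: val_inj.
apply/colP; elim/ord3_ind; rewrite !dotE !mxE ?(add0r, e11, e12, e21, e22);
  ring.
Qed.

Lemma cross0r a : cross a 0 = 0.
Proof. by apply/colP => k; rewrite !mxE !mulr0 subrr. Qed.

Lemma dotZl x a b : dot (x *: a) b = x * dot a b.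
Proof. by rewrite /dot mulr_sumr; apply: eq_bigr => i _; rewrite mxE mulrA. Qed.

Lemma dot_mulmx a b : dot a b = (a^T *m b) 0 0.
Proof. by rewrite mxE; apply: eq_bigr => i _; rewrite mxE. Qed.

(** By [cross_crossr], the cross product of the [i]-th standard basis vector
    with [cross a b] is the difference of the two sides. *)
Lemma cross_eq0_proportional a b i :
  cross a b = 0 -> b i 0 *: a = a i 0 *: b.
Proof.
have dot_delta c : dot (delta_mx i 0) c = c i 0.
  by rewrite dot_mulmx trmx_delta -rowE mxE.
move=> ab0; apply/eqP; rewrite -subr_eq0 -!dot_delta -cross_crossr ab0.
by rewrite cross0r.
Qed.

End CrossProduct.

Lemma dot_map_mx (F1 F2 : comNzRingType) (f : {rmorphism F1 -> F2})
    (a b : 'cV[F1]_3) :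
  dot (map_mx f a) (map_mx f b) = f (dot a b).
Proof. by rewrite rmorph_sum; apply: eq_bigr => i _; rewrite !mxE rmorphM. Qed.

(** An embedding in an ordered ring makes [dot w w] a sum of nonnegative
    terms, which rules out cancellation. *)
Lemma dot_self_neq0 (F : comNzRingType) (R : realDomainType)
    (f : {rmorphism F -> R}) (w : 'cV[F]_3) :
  injective f -> w != 0 -> dot w w != 0.
Proof.
move=> inj_f; apply: contraNneq => /(congr1 f).
rewrite rmorph0 rmorph_sum => /eqP.
under eq_bigr do rewrite rmorphM -expr2.
rewrite psumr_eq0 => [/allP sq0|i _]; last exact: sqr_ge0.
apply/eqP/colP => i; rewrite mxE; apply: inj_f; rewrite rmorph0.
by apply/eqP; rewrite -sqrf_eq0; exact: sq0 (mem_index_enum i).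
Qed.

(** Put [n := cross a b].  Being orthogonal to [a] and [b], [w] satisfies
    [cross w n = 0], and then [cross w (cross w n) = 0] expresses [n] as a
    multiple of [w]; the multiple has to be zero when [n] is isotropic and [w]
    is not. *)
Lemma anisotropic_cross_eq0 (F : fieldType) (w a b : 'cV[F]_3) :
    dot w a = 0 -> dot w b = 0 -> dot w w != 0 ->
  dot (cross a b) (cross a b) = 0 -> cross a b = 0.
Proof.
set n := cross a b => wa wb ww nn.
have wn0 : cross w n = 0 by rewrite cross_crossr wa wb !scale0r subrr.
have wwn : dot w n *: w = dot w w *: n.
  by apply/eqP; rewrite -subr_eq0 -cross_crossr wn0 cross0r.
have wn : dot w n = 0.
  have /eqP := congr1 (fun v => dot v n) wwn.
  by rewrite /= !dotZl nn mulr0 mulf_eq0 orbb => /eqP.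
apply/eqP; move: wwn; rewrite wn scale0r => /esym/eqP; rewrite scaler_eq0.
by rewrite (negPf ww).
Qed.

(** * Eigenvectors *)

(** Evaluating [w^T *m A *m a] on either side gives
    [alpha * dot w a = beta * dot w a]. *)
Lemma eigenvectors_orthogonal (F : fieldType) (A : 'M[F]_3)
    (w a : 'cV[F]_3) (alpha beta : F) :
    w^T *m A = alpha *: w^T -> A *m a = beta *: a -> alpha != beta ->
  dot w a = 0.
Proof.
move=> wA Aa ne; apply/eqP; have /eqP := congr1 (mulmx w^T) Aa.
rewrite mulmxA wA -scalemxAl -scalemxAr -subr_eq0 -scalerBl scaler_eq0.
by rewrite subr_eq0 (negPf ne) /= dot_mulmx => /eqP ->; rewrite mxE.
Qed.

(** If the cross product vanished, [a] and [b] would be proportional and so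
    share their eigenvalue; a common nonzero coordinate [i] makes the
    proportionality factor explicit and nonzero. *)
Lemma cross_eigenvectors_neq0 (F : fieldType) (A : 'M[F]_3)
    (a b : 'cV[F]_3) (alpha beta : F) (i : 'I_3) :
    A *m a = alpha *: a -> A *m b = beta *: b -> alpha != beta ->
    a i 0 != 0 -> b i 0 != 0 ->
  cross a b != 0.
Proof.
move=> Aa Ab ne ai bi; apply/eqP => /(cross_eq0_proportional i) prop.
have := congr1 (fun v => (A *m v) i 0) prop.
rewrite /= -!scalemxAr Aa Ab !mxE mulrCA [RHS]mulrCA (mulrC (b i 0)).
by move/(mulIf (mulf_neq0 ai bi))/eqP; rewrite (negPf ne).
Qed.

Lemma cross_eigenvectors_anisotropic (F : fieldType) (A : 'M[F]_3)
    (a b w : 'cV[F]_3) (alpha beta gamma : F) (i : 'I_3) :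
    A *m a = alpha *: a -> A *m b = beta *: b -> w^T *m A = gamma *: w^T ->
    alpha != beta -> gamma != alpha -> gamma != beta ->
    a i 0 != 0 -> b i 0 != 0 -> dot w w != 0 ->
  dot (cross a b) (cross a b) != 0.
Proof.
move=> Aa Ab wA ab ga gb ai bi ww; apply/eqP => nn.
have /eqP := cross_eigenvectors_neq0 Aa Ab ab ai bi; apply.
apply: anisotropic_cross_eq0 ww nn.
- exact: eigenvectors_orthogonal wA Aa ga.
- exact: eigenvectors_orthogonal wA Ab gb.
Qed.

(** [A - t] is singular, and so is its transpose. *)
Lemma left_eigenvector_of_right (F : fieldType) n (A : 'M[F]_n)
    (u : 'cV[F]_n) (t : F) :
    A *m u = t *: u -> u != 0 ->
  exists2 w : 'cV[F]_n, w != 0 & w^T *m A = t *: w^T.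
Proof.
move=> Au u0.
have /det0P[v v0 vA] : \det (A - t%:M) == 0.
  rewrite -det_tr; apply/det0P; exists u^T.
    by apply: contraNneq u0 => /(congr1 trmx); rewrite trmxK trmx0 => ->.
  by rewrite -trmx_mul mulmxBl mul_scalar_mx Au subrr trmx0.
exists v^T.
  by apply: contraNneq v0 => /(congr1 trmx); rewrite trmxK trmx0 => ->.
by apply/eqP; rewrite trmxK -subr_eq0 -mul_mx_scalar -mulmxBr vA.
Qed.

(** * Rational bases of a number field *)

Section RationalBasis.
Variable K : fieldExtType rat.
Implicit Type u : 'cV[K]_3.

Lemma Qbasis_neq0 u i : is_Qbasis u -> u i 0 != 0.
Proof.
move=> /basis_free/free_not0 u0; have := u0 (u i 0); apply.
by apply/tnthP; exists i; rewrite tnth_mktuple.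
Qed.

(** The point of having [A] rational is that every embedding of [K] fixes its
    entries, so eigenvectors of [A] over [K] embed to eigenvectors of [A]. *)
Lemma multiplication_matrix u (t : K) : is_Qbasis u ->
  exists A : 'M[rat]_3, map_mx ratr A *m u = t *: u.
Proof.
move=> u_basis; pose b := [tuple u i 0 | i < 3].
exists (\matrix_(i, j) coord b j (t * u i 0)); apply/colP => i.
rewrite !mxE [RHS](coord_basis u_basis (memvf _)); apply: eq_bigr => j _.
by rewrite !mxE (nth_mktuple _ _ j) -alg_num_field mulr_algl.
Qed.

Lemma map_ratr_mx (F : fieldType) (f : {rmorphism K -> F}) m n
    (A : 'M[rat]_(m, n)) :
  map_mx f (map_mx ratr A) = map_mx ratr A.
Proof. by rewrite -map_mx_comp; apply: eq_map_mx => x; apply: fmorph_rat. Qed.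

Lemma eigenvector_map (F : fieldType) (f : {rmorphism K -> F})
    (A : 'M[rat]_3) u (t : K) :
    map_mx ratr A *m u = t *: u ->
  map_mx ratr A *m map_mx f u = f t *: map_mx f u.
Proof.
by move/(congr1 (map_mx f)); rewrite map_mxM map_mxZ map_ratr_mx => <-.
Qed.

(** [u] is recovered from [v] by the inverse integer matrix, so the three
    entries of [v] span [K]; three is also the dimension, because [u] is a
    basis. *)
Lemma is_Qbasis_GL3Z u v : is_Qbasis u -> GL3Z_orbit u v -> is_Qbasis v.
Proof.
move=> u_basis [A A_unit ->]; set v' := _ *m u.
have uE : u = map_mx intr (invmx A) *m v'.
  by rewrite /v' mulmxA -map_mxM mulVmx // map_mx1 mul1mx.
have dimK : \dim {:K} = 3%N by rewrite (size_basis u_basis).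
rewrite /is_Qbasis basisEdim size_tuple dimK leqnn andbT.
rewrite -(span_basis u_basis); apply/span_subvP => _ /tnthP[i ->].
rewrite tnth_mktuple uE mxE; apply: memv_suml => j _.
rewrite mxE mulrzl -scaler_int memvZ // memv_span //.
by apply/tnthP; exists j; rewrite tnth_mktuple.
Qed.

End RationalBasis.

Lemma Qbasis_not_isotropic (R : realType) (K : fieldExtType rat)
    (sr : {rmorphism K -> R}) (sc : {rmorphism K -> R[i]}) (u : 'cV[K]_3) :
    nonreal_embedding sc -> is_Qbasis u ->
  dot (cross (xi sr u) (nu sc u)) (cross (xi sr u) (nu sc u)) != 0.
Proof.
move=> [t t_nonreal] u_basis.
have [A Au] := multiplication_matrix t u_basis.
have u0 : u != 0.
  apply: contraNneq (Qbasis_neq0 0 u_basis) => ->.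
  by rewrite mxE.
have [w w0 wA] := left_eigenvector_of_right Au u0.
pose srC : {rmorphism K -> R[i]} := real_complex R \o sr.
pose scbar : {rmorphism K -> R[i]} := (@conjc R) \o sc.
have -> : xi sr u = map_mx srC u by apply/colP => i; rewrite !mxE.
have -> : nu sc u = map_mx sc u by apply/colP => i; rewrite !mxE.
have wA' : (map_mx scbar w)^T *m map_mx ratr A = scbar t *: (map_mx scbar w)^T.
  by rewrite map_trmx -map_mxZ -wA map_mxM map_ratr_mx.
have ne_im (x y : R[i]) : complex.Im x != complex.Im y -> x != y.
  by apply: contraNneq => ->.
have ImC : complex.Im (srC t) = 0 by [].
have Imbar : complex.Im (scbar t) = - complex.Im (sc t).
  by rewrite /scbar /=; case: (sc t).
apply: (cross_eigenvectors_anisotropic (i := 0) (eigenvector_map srC Au)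
          (eigenvector_map sc Au) wA').
- by apply: ne_im; rewrite ImC eq_sym.
- by apply: ne_im; rewrite ImC Imbar oppr_eq0.
- by apply: ne_im; rewrite Imbar eq_sym -subr_eq0 opprK -mulr2n mulrn_eq0.
- by rewrite mxE fmorph_eq0 Qbasis_neq0.
- by rewrite mxE fmorph_eq0 Qbasis_neq0.
- rewrite dot_map_mx fmorph_eq0.
  exact: (dot_self_neq0 (f := sr) (fmorph_inj sr)).
Qed.

Theorem theorem2p2 (R : realType) (K : fieldExtType rat)
    (dimK : \dim {:K} = 3%N) (sigK : has_signature R K 1 1)
    (sr : {rmorphism K -> R}) (sc : {rmorphism K -> R[i]})
    (sc_nonreal : nonreal_embedding sc) :
  (forall u : 'cV[K]_3, is_Qbasis u ->
     dot (cross (xi sr u) (nu sc u)) (cross (xi sr u) (nu sc u)) <> 0)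
  /\
  (forall (L : {pred K}) (u : 'cV[K]_3), is_order L -> is_state sr L u ->
     (forall v, GL3Z_orbit u v -> ~ isotropic sr sc v) /\
     (forall C : set 'cV[K]_3, C `<=` GL3Z_orbit u ->
        C `\` isotropic sr sc = C)).
Proof.
split=> [u u_basis|L u _ [_ u_basis _]].
  exact/eqP/Qbasis_not_isotropic.
have orbit_not_isotropic v : GL3Z_orbit u v -> ~ isotropic sr sc v.
  by move=> /(is_Qbasis_GL3Z u_basis) v_basis; apply/eqP/Qbasis_not_isotropic.
split=> // C C_orbit; apply/seteqP; split=> v; first by case.
by move=> Cv; split=> //; apply/orbit_not_isotropic/C_orbit.
Qed.
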